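(* For every $n\geq 1$, the set $A=\{a_1,\ldots,a_{n-1}\}$ is a generating set of minimum size of the monoid $\mathcal{IO}_n^-$. In particular, the monoid $\mathcal{IO}_n^-$ has rank $n-1$.
   Context: Let $\Omega_n=\{1,\ldots,n\}$ with the usual linear order. Transformations of $\Omega_n$ are written on the right of their arguments and composed from left to right. $\mathcal{IO}_n$ is the monoid, under composition, of all full transformations $\alpha:\Omega_n\to\Omega_n$ that are order-preserving ($x\leq y$ implies $x\alpha\leq y\alpha$) and whose image is an interval of $\Omega_n$ (if $x\leq y\leq z$ and $x,z\in\mathrm{Im}(\alpha)$ then $y\in\mathrm{Im}(\alpha)$). $\mathcal{IO}_n^-$ is the submonoid of those $\alpha\in\mathcal{IO}_n$ with $x\alpha\leq x$ for all $x\in\Omega_n$. For $1\leq i\leq n-1$, $a_i\in\mathcal{IO}_n^-$ is the transformation with $xa_i=x$ for $x\leq i$ and $xa_i=x-1$ for $x\geq i+1$ (for $n=1$ the set $A$ is empty). Generating sets are taken in the sense of monoids (the identity is the empty product). The rank of a finite monoid $M$ is the minimum size of a generating set of $M$. *)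

(* Defs.v *)
From HB Require Import structures.
From mathcomp Require Import all_boot.

Set Implicit Arguments.
Unset Strict Implicit.
Unset Printing Implicit Defensive.

Local Open Scope group_scope.

#[short(type="finMonoidType")]
HB.structure Definition FinMonoid := {M of monoid.Monoid M & Finite M}.

Section Generation.
Variable M : finMonoidType.
Implicit Types (x : M) (A B S : {set M}).

Definition submonoid_set S :=
  (1 \in S) && [forall x in S, forall y in S, x * y \in S].

(* The least submonoid containing A; genP below gives the description by
   products, the empty product included. *)
Definition gen A := \bigcap_(S | submonoid_set S && (A \subset S)) S.

Definition generates A := gen A == [set: M].

Definition min_generates A :=
  generates A && [forall B, generates B ==> (#|A| <= #|B|)].

Definition rank := #|[arg min_(A < [set: M] | generates A) #|A|]|.

Lemma genP A x :
  reflect (exists2 s : seq M, {subset s <= A} & x = \prod_(a <- s) a)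
          (x \in gen A).
Proof.
pose e := [rel y z | [exists a in A, z == y * a]].
have eP y s : {subset s <= A} -> connect e y (y * \prod_(a <- s) a).
  elim: s y => [|a s IHs] y sA; first by rewrite big_nil mulg1.
  rewrite big_cons mulgA.
  have sA' : {subset s <= A} by move=> b bs; rewrite sA // inE bs orbT.
  apply: connect_trans (IHs (y * a) sA').
  apply/connect1/existsP; exists a; by rewrite sA ?mem_head /=.
have eI y z : connect e y z ->
    exists2 s : seq M, {subset s <= A} & z = y * \prod_(a <- s) a.
  case/connectP => p; elim: p y => [|w p IHp] y /=.
    by move=> _ ->; exists [::]; rewrite ?big_nil ?mulg1.
  case/andP=> /existsP [a /andP [aA /eqP ->]] /IHp {}IHp /IHp [s sA ->].
  exists (a :: s); last by rewrite big_cons mulgA.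
  by move=> b; rewrite inE => /predU1P [->|/sA].
apply: (iffP idP) => [/bigcapP xA | [s sA ->]].
  have /xA : submonoid_set [set y | connect e 1 y]
             && (A \subset [set y | connect e 1 y]).
    apply/andP; split; last first.
      apply/subsetP => a aA; rewrite inE -[a in connect _ _ a]mul1g.
      by apply/connect1/existsP; exists a; rewrite aA /=.
    rewrite /submonoid_set inE connect0 /=.
    apply/forall_inP => y; rewrite inE => ey.
    apply/forall_inP => z; rewrite inE => /eI [s sA ->].
    by rewrite mul1g inE; apply: connect_trans ey (eP y s sA).
  by rewrite inE => /eI [s sA ->]; exists s; rewrite ?mul1g.
apply/bigcapP => S /andP [/andP [S1 SM] /subsetP AS].
elim: s sA => [|a s IHs] sA; first by rewrite big_nil.
rewrite big_cons (forall_inP (forall_inP SM _ _)) //.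
  by rewrite AS // sA ?mem_head.
by apply: IHs => b bs; rewrite sA // inE bs orbT.
Qed.

Lemma generates_setT : generates [set: M].
Proof.
rewrite /generates eqEsubset subsetT; apply/subsetP => x _.
by apply/genP; exists [:: x]; rewrite ?big_seq1 // => y _; rewrite inE.
Qed.

Lemma rankP : exists2 A, min_generates A & #|A| = rank.
Proof.
rewrite /rank; case: arg_minnP => [|A gA minA]; first exact: generates_setT.
exists A => //; rewrite /min_generates gA.
by apply/forallP => B; apply/implyP => /minA.
Qed.

End Generation.

Arguments rank : clear implicits.

Section Transformations.
Variable n : nat.

(* 'I_n = {0, ..., n - 1} plays the role of {1, ..., n}. *)
Definition transf := {ffun 'I_n -> 'I_n}.
HB.instance Definition _ := Finite.copy transf {ffun 'I_n -> 'I_n}.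

(* Left-to-right composition: x (f * g) = (x f) g. *)
Definition transf_mul (f g : transf) : transf := [ffun x => g (f x)].
Definition transf_one : transf := [ffun x => x].

Fact transf_mulA : associative transf_mul.
Proof. by move=> f g h; apply/ffunP => x; rewrite !ffunE. Qed.
Fact transf_mul1 : left_id transf_one transf_mul.
Proof. by move=> f; apply/ffunP => x; rewrite !ffunE. Qed.
Fact transf_mulr1 : right_id transf_one transf_mul.
Proof. by move=> f; apply/ffunP => x; rewrite !ffunE. Qed.
HB.instance Definition _ := isMonoid.Build transf
  transf_mulA transf_mul1 transf_mulr1.

Definition order_preserving (f : transf) :=
  [forall x : 'I_n, forall y : 'I_n, (x <= y) ==> (f x <= f y)].

Definition interval_image (f : transf) :=
  [forall x : 'I_n, forall y : 'I_n, forall z : 'I_n,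
    [&& x <= y <= z, x \in codom f & z \in codom f] ==> (y \in codom f)].

Definition is_IO : pred transf :=
  fun f => order_preserving f && interval_image f.

Fact is_IO_closed : monoid_closed is_IO.
Proof.
split.
  apply/andP; split.
    by apply/'forall_forallP => x y; apply/implyP; rewrite !ffunE.
  apply/forallP => x; apply/'forall_forallP => y z; apply/implyP => _.
  by apply/codomP; exists y; rewrite ffunE.
move=> f g /andP [fO fI] /andP [gO gI].
have fO' (x y : 'I_n) : x <= y -> f x <= f y by apply/implyP/(forallP (forallP fO x)).
have gO' (x y : 'I_n) : x <= y -> g x <= g y by apply/implyP/(forallP (forallP gO x)).
apply/andP; split.
  apply/'forall_forallP => x y; apply/implyP => xy.
  by rewrite !ffunE gO' // fO'.
apply/forallP => x; apply/'forall_forallP => y z.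
apply/implyP => /and3P [/andP [xy yz] /codomP [u xE] /codomP [v zE]].
rewrite !ffunE in xE zE.
have /codomP [w yE] : y \in codom g.
  apply: (implyP (forallP (forallP (forallP gI x) y) z)).
  by rewrite xy yz xE zE !codom_f.
have fcod (t : 'I_n) : f u <= t <= f v -> t \in codom f.
  move=> ut; apply: (implyP (forallP (forallP (forallP fI (f u)) t) (f v))).
  by rewrite ut !codom_f.
have sub (t : 'I_n) : t \in codom f -> g t = y -> y \in codom (f * g).
  by case/codomP => s ->  <-; apply/codomP; exists s; rewrite ffunE.
case: (leqP (f u) w) => [uw|/ltnW wu].
  case: (leqP w (f v)) => [wv|/ltnW vw].
    by apply: (sub w) => //; apply: fcod; rewrite uw.
  apply: (sub (f v)); first exact: codom_f.
  apply/val_inj/eqP; rewrite eqn_leq -{2}zE yz andbT.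
  by rewrite [in X in _ <= X]yE gO'.
apply: (sub (f u)); first exact: codom_f.
apply/val_inj/eqP; rewrite eqn_leq -{1}xE xy /=.
by rewrite [in X in X <= _]yE gO'.
Qed.

Record IO := MkIO { IO_val :> transf; _ : is_IO IO_val }.
HB.instance Definition _ := [isSub for IO_val].
HB.instance Definition _ := [Finite of IO by <:].
HB.instance Definition _ :=
  SubChoice_isSubMonoid.Build transf is_IO IO is_IO_closed.

Definition order_decreasing : pred IO := fun f => [forall x, IO_val f x <= x].

Fact order_decreasing_closed : monoid_closed order_decreasing.
Proof.
split; first by apply/forallP => x; rewrite ffunE.
move=> f g /forallP fD /forallP gD; apply/forallP => x.
by rewrite ffunE; apply: leq_trans (gD _) (fD x).
Qed.

Record IOm := MkIOm { IOm_val :> IO; _ : order_decreasing IOm_val }.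
HB.instance Definition _ := [isSub for IOm_val].
HB.instance Definition _ := [Finite of IOm by <:].
HB.instance Definition _ :=
  SubChoice_isSubMonoid.Build IO order_decreasing IOm
    order_decreasing_closed.

(* The shift of the points and of the index i by one cancel out, so the
   inequalities are those of the 1-based definition. *)
Definition a_transf (i : 'I_n.-1) : transf :=
  [ffun x : 'I_n => if x <= i then x
                    else Ordinal (leq_ltn_trans (leq_pred x) (ltn_ord x))].

Lemma a_transfE i (x : 'I_n) :
  a_transf i x = (if x <= i then x : nat else x.-1) :> nat.
Proof. by rewrite ffunE; case: ifP. Qed.

Fact a_is_IO i : is_IO (a_transf i).
Proof.
apply/andP; split.
  apply/'forall_forallP => x y; apply/implyP; rewrite !a_transfE => xy.
  case: (leqP x i) => xi; case: (leqP y i) => yi //.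
  - by rewrite -ltnS (ltn_predK yi) (leq_ltn_trans xi).
  - exact: leq_trans (leq_pred x) xy.
  - by rewrite -!subn1 leq_sub2r.
apply/forallP => x; apply/'forall_forallP => y z.
apply/implyP => /and3P [/andP [_ yz] _ /codomP [v zE]]; apply/codomP.
case: (leqP y i) => yi.
  by exists y; apply: val_inj; rewrite /= a_transfE yi.
have yn : y.+1 < n.
  apply: leq_ltn_trans (ltn_ord v).
  have := a_transfE i v; rewrite -zE; case: (leqP v i) => vi zv.
    have := leq_trans yi (leq_trans yz _).
    by rewrite zv => /(_ _ vi); rewrite ltnn.
  by rewrite -(ltn_predK vi) ltnS -zv.
exists (Ordinal yn); apply: val_inj; rewrite /= a_transfE /=.
by rewrite leqNgt (ltn_trans yi).
Qed.

Fact a_decreasing i : order_decreasing (MkIO (a_is_IO i)).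
Proof.
by apply/forallP => x /=; rewrite a_transfE; case: ifP => // _; apply: leq_pred.
Qed.

Definition a_gen (i : 'I_n.-1) : IOm := MkIOm (a_decreasing i).

Definition A_gens : {set IOm} := [set a_gen i | i : 'I_n.-1].

End Transformations.

Arguments A_gens : clear implicits.

(* Main.v *)
Require Import Defs.
From mathcomp Require Import all_boot.

(* Extending a decreasing map f of {0, ..., m} to F : nat -> nat by unit steps
   beyond m, membership in IO^- says that F 0 = 0 and that F has steps 0 or 1.
   If f is not the identity, then F (i + 1) = F i for some i < m, and f = a_i g
   where g is F with the argument i + 1 skipped; g lies pointwise above f and
   is strictly larger at m, so iterating this reaches the identity.
   Conversely, if a_i = f g with f <> 1, then f can be stationary only where
   a_i is, namely from i to i + 1; this forces f = a_i. Hence every generating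
   set contains all the a_i. *)

(** * Irreducible elements of a finite monoid *)

Section Irreducible.
Local Open Scope group_scope.

Lemma gen_irreducible (M : finMonoidType) (B : {set M}) (x : M) :
  x != 1 -> (forall y z : M, x = y * z -> y = 1 \/ y = x) ->
  x \in gen B -> x \in B.
Proof.
move=> x1 irr /genP [s]; elim: s => [|y s IHs] sB.
  by rewrite big_nil => xE; rewrite xE eqxx in x1.
rewrite big_cons => xE.
case: (irr _ _ xE) => [y1|<-]; last by rewrite sB ?mem_head.
apply: IHs => [b bs|]; first by rewrite sB // inE bs orbT.
by rewrite xE y1 mul1g.
Qed.

End Irreducible.

Section UnitStepMaps.
Local Open Scope group_scope.
Variable m : nat.
Implicit Types (f g : IOm m.+1) (h : nat -> nat).

(** * Elements of IO^- as unit-step maps *)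

Lemma IOm_eqP f g : (forall x, IO_val f x = IO_val g x :> nat) -> f = g.
Proof.
by move=> fg; apply/val_inj/val_inj/ffunP => x; apply: val_inj; apply: fg.
Qed.

Lemma IOm_mulE f g x : IO_val (f * g) x = IO_val g (IO_val f x).
Proof. by rewrite ffunE. Qed.

Lemma IOm_oneE x : IO_val (1 : IOm m.+1) x = x.
Proof. by rewrite ffunE. Qed.

Lemma IOm_le f x : IO_val f x <= x.
Proof. by case: f => f /= /forallP. Qed.

Lemma IOm_homo f (x y : 'I_m.+1) : x <= y -> IO_val f x <= IO_val f y.
Proof.
case: f => [[f /= /andP [fO _]] _].
exact/implyP/(forallP (forallP fO x)).
Qed.

Lemma IOm_step f (x y : 'I_m.+1) : y = x.+1 :> nat ->
  IO_val f y <= (IO_val f x).+1.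
Proof.
move=> yE; rewrite leqNgt; apply/negP => lt_f.
have wn : (IO_val f x).+1 < m.+1.
  exact: ltn_trans lt_f (ltn_ord _).
have /codomP [w wE] : Ordinal wn \in codom (IO_val f).
  case: f lt_f wn => [[f /= /andP [_ fI]] _] /= lt_f wn.
  apply: (implyP (forallP (forallP (forallP fI (f x)) _) (f y))).
  by rewrite /= leqnSn (ltnW lt_f) !codom_f.
have {}wE : IO_val f w = (IO_val f x).+1 :> nat by rewrite -wE.
(* The skipped value can be attained neither up to [x] nor from [y] on, by monotonicity. *)
case: (leqP w x) => [/(IOm_homo f)|]; first by rewrite wE ltnn.
by rewrite -yE => /(IOm_homo f); rewrite wE leqNgt lt_f.
Qed.

(** Defined on all of [nat], so that an argument may be shifted past [m]. *)
Definition unit_step h := h 0 = 0 /\ forall x, h x <= h x.+1 <= (h x).+1.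

Lemma unit_step_homo h : unit_step h -> {homo h : x y / x <= y}.
Proof.
case=> _ hS; apply: homo_leq => // [y x z|x]; first exact: leq_trans.
by case/andP: (hS x).
Qed.

Lemma unit_step_leq h x y : unit_step h -> x <= y -> h y <= h x + (y - x).
Proof.
case=> _ hS /subnKC {1}<-; elim: (y - x) => [|d IHd]; first by rewrite !addn0.
by rewrite !addnS; case/andP: (hS (x + d)) => _ /leq_trans -> //; rewrite ltnS.
Qed.

Lemma unit_step_le h x : unit_step h -> h x <= x.
Proof.
move=> hS; have := unit_step_leq _ _ _ hS (leq0n x).
by case: hS => ->; rewrite subn0.
Qed.

Lemma unit_step_ivt h v y :
  unit_step h -> y <= h v -> exists2 w, w <= v & h w = y.
Proof.
move=> [h0 hS]; elim: v => [|v IHv].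
  by rewrite h0 leqn0 => /eqP ->; exists 0.
rewrite leq_eqVlt => /predU1P [->|lt_y]; first by exists v.+1.
case: IHv => [|w wv <-]; last by exists w; rewrite ?leqW.
by rewrite -ltnS (leq_trans lt_y) //; case/andP: (hS v).
Qed.

Lemma IOm_extension f :
  exists2 F, unit_step F
           & (forall x, IO_val f x = F x :> nat) /\ F m.+1 = (F m).+1.
Proof.
(* [minn x m] keeps [inord] off its default value; the truncated [x - m] vanishes up to [m] and
   gives slope 1 beyond. *)
exists (fun x => IO_val f (inord (minn x m)) + (x - m)); last first.
  split=> [x|]; last first.
    by rewrite minnn subnn addn0 (minn_idPr (leqnSn m)) subSnn addn1.
  have xm : x <= m by rewrite -ltnS.
  rewrite (minn_idPl xm) inord_val; move: xm.
  by rewrite -subn_eq0 => /eqP ->; rewrite addn0.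
split=> [|x] /=.
  rewrite min0n addn0; apply/eqP; rewrite -leqn0.
  by apply: leq_trans (IOm_le _ _) _; rewrite inordK.
case: (ltnP x m) => [xm|mx] /=; last first.
  by rewrite (minn_idPr (leqW mx)) subSn // addnS leqnSn /=.
have -> : x - m = 0 by apply/eqP; rewrite subn_eq0 ltnW.
have -> : x.+1 - m = 0 by apply/eqP; rewrite subn_eq0.
rewrite !addn0 (minn_idPl xm).
rewrite IOm_homo ?IOm_step ?inordK // ltnS // ltnW //.
Qed.

Lemma IOm_of_unit_step h :
  unit_step h -> exists f, forall x, IO_val f x = h x :> nat.
Proof.
move=> hS.
have hm (x : 'I_m.+1) : h x < m.+1.
  exact: leq_ltn_trans (unit_step_le _ _ hS) (ltn_ord x).
pose t : transf m.+1 := [ffun x => Ordinal (hm x)].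
have tE x : t x = h x :> nat by rewrite ffunE.
have tIO : is_IO t.
  apply/andP; split.
    apply/'forall_forallP => x y; apply/implyP; rewrite !tE.
    exact: unit_step_homo.
  apply/forallP => x; apply/'forall_forallP => y z.
  apply/implyP => /and3P [/andP [_ yz] _ /codomP [v zE]].
  rewrite zE tE in yz; case: (unit_step_ivt _ _ _ hS yz) => w wv hw.
  apply/codomP; exists (Ordinal (leq_ltn_trans wv (ltn_ord v))).
  by apply: val_inj; rewrite /= tE.
have tD : order_decreasing (MkIO tIO).
  by apply/forallP => x /=; rewrite tE unit_step_le.
by exists (MkIOm tD).
Qed.

Lemma IOm_stationary f :
  f != 1 -> exists i : 'I_m, IO_val f (inord i.+1) = IO_val f (inord i) :> nat.
Proof.
case: (IOm_extension f) => F FS [fF _] f1.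
case: (boolP [exists i : 'I_m, F i.+1 == F i]) => [/existsP [i /eqP iE]|].
  by exists i; rewrite !fF !inordK // ltnS // ltnW.
rewrite negb_exists => /forallP inc; case/eqP: f1; apply: IOm_eqP => x.
rewrite IOm_oneE fF; have: x <= m by rewrite -ltnS.
elim: {x}(x : nat) => [|x IHx] xm; first by case: FS.
(* Without stationary steps [F] climbs by at least 1 each time, while it stays below the
   identity. *)
have := inc (Ordinal xm); rewrite /= neq_ltn ltnNge unit_step_homo //= => ltF.
apply/eqP; rewrite eqn_leq unit_step_le //=.
by rewrite -{1}(IHx (ltnW xm)) ltF.
Qed.

(** The step from [i] to [i + 1] gains nothing, so every later point lies at least one below the
    diagonal. *)
Lemma IOm_stationary_le f i j (x : 'I_m.+1) :
  IO_val f j = IO_val f i :> nat -> j = i.+1 :> nat -> i < x ->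
  IO_val f x <= x.-1.
Proof.
case: (IOm_extension f) => F FS [fF _]; rewrite !fF => Fji jE ix.
rewrite jE in Fji.
apply: leq_trans (unit_step_leq _ _ _ FS ix) _; rewrite Fji.
apply: leq_trans (leq_add (unit_step_le _ _ FS) (leqnn _)) _.
by rewrite subnS -subn1 addnBA ?subn_gt0 // subnKC ?subn1 // ltnW.
Qed.

(** * Factorization and generation *)

Lemma a_genE (i : 'I_m.+1.-1) (x : 'I_m.+1) :
  IO_val (a_gen i) x = (if x <= i then x : nat else x.-1) :> nat.
Proof. exact: a_transfE. Qed.

Lemma a_gen_factor f :
  f != 1 -> exists i g, [/\ f = a_gen i * g,
    forall x, IO_val f x <= IO_val g x
    & IO_val f ord_max < IO_val g ord_max].
Proof.
move=> /IOm_stationary [i fi].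
case: (IOm_extension f) => F FS [fF Fm].
have FiE : F i.+1 = F i.
  by move: fi; rewrite !fF !inordK // ltnS // ltnW.
pose h x := F (if x <= i then x else x.+1).
have hS : unit_step h.
  case: FS => F0 FS; split=> [|x] //; rewrite /h.
  case: (ltngtP x i) => xi; [exact: FS | exact: FS |].
  by rewrite xi -FiE; apply: FS.
have Fh x : F x <= h x.
  by rewrite /h; case: ifP => // _; case: FS => _ /(_ x) /andP [].
case: (IOm_of_unit_step _ hS) => g gh; exists i, g; split.
- apply: IOm_eqP => x; rewrite IOm_mulE gh fF a_genE /h.
  (* The skipped argument [x = i + 1] is sent to [i] by [a_gen i], where [F] has the same value. *)
  case: (leqP x i) => [-> //|ix]; case: leqP => xi.
    have -> : (x : nat) = i.+1.
      by apply/eqP; rewrite eqn_leq ix -(ltn_predK ix) ltnS xi.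
    exact: FiE.
  by rewrite (ltn_predK ix).
- by move=> x; rewrite fF gh.
(* As [i < m], [h m] is the value of [F] at the added point [m + 1], hence strictly larger than
   [F m]. *)
by rewrite fF gh /h /= (leqNgt m i) ltn_ord /= Fm.
Qed.

Lemma A_gens_generates : generates (A_gens m.+1).
Proof.
rewrite /generates eqEsubset subsetT; apply/subsetP => f _.
pose gap f := \sum_(x < m.+1) (m - IO_val f x).
elim: {f}(gap f).+1 {-2}f (ltnSn (gap f)) => // k IHk f; rewrite ltnS => fk.
have [->|/a_gen_factor [i [g [fE fg lt_fg]]]] := eqVneq f 1.
  by apply/genP; exists [::]; rewrite ?big_nil.
have /IHk /genP [s sA gE] : gap g < k.
  apply: leq_trans fk; rewrite /gap (bigD1 ord_max) //=.
  rewrite [X in _ < X](bigD1 ord_max) //= -addSn.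
  apply: leq_add; last by apply: leq_sum => x _; rewrite leq_sub2l.
  by rewrite ltn_sub2l // (leq_trans lt_fg) // -ltnS.
apply/genP; exists (a_gen i :: s); last by rewrite big_cons fE gE.
by move=> b; rewrite inE => /predU1P [->|/sA //]; rewrite imset_f.
Qed.

(** * Irreducibility of the generators and minimality *)

Lemma a_gen_neq1 (i : 'I_m.+1.-1) : a_gen i != 1.
Proof.
apply/eqP => aE.
have := a_genE i (inord i.+1); rewrite aE IOm_oneE inordK ?ltnS // ltnn /=.
by move/esym/n_Sn.
Qed.

Lemma a_gen_irreducible (i : 'I_m.+1.-1) f g :
  a_gen i = f * g -> f = 1 \/ f = a_gen i.
Proof.
move=> aE; have [->|/IOm_stationary [j fj]] := eqVneq f 1; [by left | right].
have jK : (inord j : 'I_m.+1) = j :> nat by rewrite inordK // ltnS ltnW.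
have jSK : (inord j.+1 : 'I_m.+1) = j.+1 :> nat by rewrite inordK // ltnS.
(* If [f] agrees at [j] and [j + 1], so does [f * g = a_gen i], which happens only at [i]. *)
have ji : j = i :> nat.
  have := a_genE i (inord j.+1); rewrite aE IOm_mulE (val_inj fj) -IOm_mulE -aE.
  rewrite a_genE jK jSK /=; case: (ltngtP j i) => // [_ /n_Sn //|].
  by case: (j : nat) => // k _ /n_Sn.
(* The upper bound on [f] comes from its stationary step at [i], the lower one from [g] being
   decreasing. *)
apply: IOm_eqP => x; apply/eqP; rewrite eqn_leq; apply/andP; split.
  rewrite a_genE; case: (leqP x i) => xi; first exact: IOm_le.
  by apply: IOm_stationary_le fj _ _; rewrite ?jSK jK ?ji.
by rewrite aE IOm_mulE IOm_le.
Qed.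

Lemma A_gens_sub (B : {set IOm m.+1}) : generates B -> A_gens m.+1 \subset B.
Proof.
move=> /eqP gB; apply/subsetP => _ /imsetP [i _ ->].
apply: gen_irreducible (a_gen_neq1 i) (a_gen_irreducible i) _.
by rewrite gB inE.
Qed.

Lemma card_A_gens : #|A_gens m.+1| = m.
Proof.
rewrite card_imset ?card_ord // => i j aij; apply: val_inj.
(* If [k < l], then [a_gen l] fixes [k + 1] while [a_gen k] moves it. *)
have le (k l : 'I_m.+1.-1) : a_gen k = a_gen l -> l <= k.
  move=> akl; have := a_genE k (inord k.+1); rewrite akl a_genE inordK ?ltnS //.
  by rewrite ltnn /=; case: leqP => // _ /esym/n_Sn.
by apply/eqP; rewrite eqn_leq !le.
Qed.

End UnitStepMaps.

Theorem theorem3p4 (n : nat) (n_ge1 : 1 <= n) :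
  min_generates (A_gens n) /\ rank (IOm n) = n - 1.
Proof.
case: n n_ge1 => // m _; rewrite subn1 /=.
have minA : min_generates (A_gens m.+1).
  apply/andP; split; first exact: A_gens_generates.
  by apply/forallP => B; apply/implyP => /A_gens_sub /subset_leq_card.
split=> //; case: (rankP (IOm m.+1)) => B /andP [gB /forallP minB] <-.
case/andP: minA => gA /forallP /(_ B); rewrite gB /= => AB.
move: (minB (A_gens m.+1)); rewrite gA /= => BA.
by rewrite -[RHS](card_A_gens m); apply/eqP; rewrite eqn_leq AB BA.
Qed.
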